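(* Let $0\le\alpha\le 1$. In the annotation model, given a $b\times c$ matrix $A$ and a $c$-dimensional vector $\mathbf{x}$ whose entries arrive in a data stream, the product $A\mathbf{x}$ can be verified with a valid $(b c^{\alpha}, c^{1-\alpha})$ protocol. Moreover, any such protocol requires help cost times verification cost $=\Omega(\min(c,b)^2)$ bits for dense matrices.
   Context: Annotation model: a data stream $\mathcal{A}$ of length $m$ is observed by a probabilistic verifier $\mathcal{V}$ (private random string, $w(m)$ machine words of working memory, each word $\Theta(\log m)$ bits) and a deterministic helper $\mathcal{H}$. After the stream ends, $\mathcal{H}$ sends an annotation that $\mathcal{V}$ reads as a stream. $\mathcal{V}$ outputs a value or $\perp$. A helper is valid for $\mathcal{A}$ if $\mathcal{V}$ outputs $f(\mathcal{A})$ with probability 1; it is $\tfrac13$-invalid for $\mathcal{A}$ if $\mathcal{V}$ outputs something other than $\perp$ with probability at most $1/3$. A protocol for $f$ is valid if some helper is valid for every $\mathcal{A}$, and for every helper and every stream, the helper is either valid or $\tfrac13$-invalid. Help cost: maximum annotation length of a shortest valid helper (in words); verification cost: $w(m)$ (in words); lower bounds on their product are in bits. An $(h,v)$ protocol is a valid protocol with help cost $O(h+1)$ and verification cost $O(v+1)$. Stream items specify an index and a value for an entry of $A$ or $\mathbf{x}$, in arbitrary order.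
   Formalization: In the product a help cost of zero counts as one bit, since a verifier that stores the input needs no help; entries are integers and they and bc are bounded by a fixed power of m; dense means at least δbc nonzero entries, with m at least δbc + c. *)

(* Defs.v *)
From mathcomp Require Import all_boot all_order all_algebra.
From mathcomp Require Import reals exp.

Set Implicit Arguments.
Unset Strict Implicit.
Unset Printing Implicit Defensive.

Import Order.TTheory GRing.Theory Num.Theory.
Local Open Scope ring_scope.

(* A machine word for streams of length m.  Any other choice of word length
   Theta(log m) changes costs counted in words only by constant factors. *)
Definition word_bits (m : nat) : nat := (trunc_log 2 m).+1.
Definition word (m : nat) : finType := (word_bits m).-tuple bool.

(* A verifier with w words of working memory, for streams of length m.
   [coins] is the set of private random strings, with the uniform
   distribution.  The output is a sequence which may be longer than the memory
   (A x has b entries), so it goes to a write-only tape: the verifier appends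
   to it while it reads the annotation, and at the end either appends the last
   items ([finish] = Some _) or discards everything and outputs bottom
   ([finish] = None). *)
Record verifier (I : Type) (O : eqType) (m w : nat) := Verifier {
  coins : finType;
  start : coins -> w.-tuple (word m);
  read_item : coins -> w.-tuple (word m) -> I -> w.-tuple (word m);
  read_word : coins -> w.-tuple (word m) -> word m ->
                w.-tuple (word m) * seq O;
  finish : coins -> w.-tuple (word m) -> option (seq O)
}.

Section Protocols.
Variables (I : Type) (O : eqType) (m w : nat) (V : verifier I O m w).

Fixpoint read_annotation (r : coins V) (mem : w.-tuple (word m))
    (a : seq (word m)) : option (seq O) :=
  if a is u :: a' then
    let: (mem', o) := read_word r mem u in
    omap (cat o) (read_annotation r mem' a')
  else finish r mem.

(* None is the output bottom. *)
Definition output (r : coins V) (s : seq I) (a : seq (word m)) :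
    option (seq O) :=
  read_annotation r (foldl (read_item r) (start r) s) a.

Definition Pr (P : pred (coins V)) : rat := #|P|%:R / #|{: coins V}|%:R.

(* In general the transitions depend on the coins: a verifier may consult its
   whole random string at any time, at no cost in memory.  A verifier
   satisfying [coins_in_memory] tosses all its coins at the start, and what it
   uses of them later is part of its working memory. *)
Definition coins_in_memory : Prop :=
  forall r r' : coins V,
    [/\ read_item r =2 read_item r',
        read_word r =2 read_word r' & finish r =1 finish r'].

Definition helper := seq I -> seq (word m).

Variable f : seq I -> seq O.

Definition valid_helper (H : helper) (s : seq I) : Prop :=
  Pr [pred r | output r s (H s) == Some (f s)] = 1.

Definition third_invalid_helper (H : helper) (s : seq I) : Prop :=
  Pr [pred r | output r s (H s) != None] <= 1 / 3%:R.

(* S is the set of admissible streams. *)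
Variable S : seq I -> Prop.

Definition valid_protocol : Prop :=
  (exists H : helper, forall s, S s -> valid_helper H s) /\
  (forall (H : helper) s, S s ->
     valid_helper H s \/ third_invalid_helper H s).

Definition help_cost_le (n : nat) : Prop :=
  exists H : helper,
    forall s, S s -> valid_helper H s /\ (size (H s) <= n)%N.

Definition help_cost (n : nat) : Prop :=
  help_cost_le n /\ forall n', help_cost_le n' -> (n <= n')%N.

(* An (h, v) protocol; K is the constant of both O(_). *)
Definition hv_protocol (R : realType) (K h v : R) : Prop :=
  [/\ valid_protocol,
      exists2 n, help_cost n & n%:R <= K * (h + 1)
    & w%:R <= K * (v + 1)].

End Protocols.

Section MatrixVector.
Variables (b c : nat).

(* inl (i, j) is the (i, j) entry of A and inr j the j-th entry of x. *)
Definition mv_index : finType := (('I_b * 'I_c) + 'I_c)%type.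

Definition mv_item : Type := (mv_index * int)%type.

(* In a well-formed stream there is at most one item for each index, so this
   is the value specified for k, and 0 when no value is specified. *)
Definition entry (s : seq mv_item) (k : mv_index) : int :=
  \sum_(p <- s | p.1 == k) p.2.

Definition stream_matrix (s : seq mv_item) : 'M[int]_(b, c) :=
  \matrix_(i, j) entry s (inl (i, j)).

Definition stream_vector (s : seq mv_item) : 'cV[int]_c :=
  \col_j entry s (inr j).

Definition mv_product (s : seq mv_item) : seq int :=
  [seq (stream_matrix s *m stream_vector s) i 0 | i <- enum 'I_b].

(* The bound m ^ kappa makes every value fit in O(1) words. *)
Definition mv_stream (m kappa : nat) (s : seq mv_item) : Prop :=
  [/\ size s = m,
      uniq [seq p.1 | p <- s]
    & forall p, p \in s -> (`|p.2| <= m ^ kappa)%N].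

Definition dense (R : realType) (delta : R) (A : 'M[int]_(b, c)) : Prop :=
  delta * b%:R * c%:R <= #|[set ij : 'I_b * 'I_c | A ij.1 ij.2 != 0]|%:R.

Definition dense_mv_stream (R : realType) (delta : R) (m kappa : nat)
    (s : seq mv_item) : Prop :=
  mv_stream m kappa s /\ dense delta (stream_matrix s).

End MatrixVector.

(* Main.v *)
Require Import Defs.
From mathcomp Require Import all_boot all_order all_algebra.
From mathcomp Require Import boolp reals exp.
From mathcomp Require Import zify ring lra.

(* Upper bound.  Split the column indices as j = (j / v, j mod v) with
   v ~ c^(1-alpha) and C ~ c^alpha blocks.  For each row i the polynomial
   t_i(X) = sum_y (sum_(j mod v = y) A_ij X^(j / v))
                  (sum_(j mod v = y) x_j X^(C-1 - j / v))
   has degree at most 2C-2, and its coefficient of degree C-1 is (A x)_i.  The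
   annotation lists the coefficients of t_0, ..., t_(b-1) over a prime field
   F_p with p polynomial in m.  While it reads the stream, the verifier keeps,
   for random r and rho, the 2v linear sketches
   sum_i rho^i sum_(j mod v = y) A_ij r^(j / v)  and
   sum_(j mod v = y) x_j r^(C-1 - j / v),
   whose dot product is sum_i rho^i t_i(r).  It compares this with the value
   obtained from the annotation; a wrong annotation passes with probability at
   most (deg + b) / p.  A prime p of O(1) words exists because central binomial
   coefficients are large while their prime powers are small.

   Lower bound.  Fix a set P of m - c positions, choose signs on P, and take x
   to be a unit vector e_j.  With annotations of H bits, H + O(1) independent
   copies make the error small enough for a union bound over all annotations,
   so the memory states of the copies before x arrives determine most columns
   of most sign patterns.  If the memory has W bits, counting gives
   |P| = O(max(H, 1) W + c). *)

Set Implicit Arguments.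
Unset Strict Implicit.
Unset Printing Implicit Defensive.

Import Order.TTheory GRing.Theory Num.Theory.

(** * Primes between powers of two *)

Lemma expn2_leq_central_bin n : 2 ^ n <= 'C(n.*2, n).
Proof.
elim: n => // n IHn; rewrite doubleS binS expnS mul2n -addnn.
have mono k : 'C(n.*2, k) <= 'C(n.*2.+1, k).
  by case: k => [|k]; rewrite ?bin0 // binS leq_addr.
by rewrite leq_add // (leq_trans IHn) // binS leq_addl.
Qed.

(** Legendre's formula with the range padded by zero terms up to a common [N], so that the sums for
    n and 2n can be compared term by term. *)
Lemma logn_fact_ub p n N : prime p -> n <= N ->
  logn p n`! = \sum_(1 <= k < N.+1) n %/ p ^ k.
Proof.
move=> p_pr leN; rewrite logn_fact // [RHS](big_cat_nat (n := n.+1)) //=.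
rewrite [X in _ = _ + X]big1_seq ?addn0 // => k /andP[_]; rewrite mem_index_iota => /andP[nk _].
by rewrite divn_small // (leq_trans nk) // ltnW // ltn_expl // prime_gt1.
Qed.

(* Legendre's formula: each power p^k <= 2n contributes at most 1 to the
   valuation, the larger ones nothing. *)
Lemma pfactor_central_bin p n : prime p -> 0 < n ->
  p ^ logn p 'C(n.*2, n) <= n.*2.
Proof.
move=> p_pr n_gt0; have p_gt1 := prime_gt1 p_pr.
have n2_gt0 : 0 < n.*2 by rewrite double_gt0.
apply: leq_trans (trunc_logP p_gt1 n2_gt0); rewrite leq_exp2l //.
set t := trunc_log p n.*2.
have le_n : n <= n.*2 by rewrite -addnn leq_addr.
have := congr1 (logn p) (bin_fact le_n).
rewrite -addnn addnK addnn !lognM ?muln_gt0 ?fact_gt0 ?bin_gt0 //.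
rewrite (logn_fact_ub p_pr le_n) (logn_fact_ub p_pr (leqnn _)) => eqL.
suff : \sum_(1 <= k < n.*2.+1) n.*2 %/ p ^ k <=
       t + (\sum_(1 <= k < n.*2.+1) n %/ p ^ k + \sum_(1 <= k < n.*2.+1) n %/ p ^ k).
  by rewrite -eqL leq_add2r.
have tn : t <= n.*2.
  by apply: leq_trans (trunc_logP p_gt1 n2_gt0); rewrite ltnW // ltn_expl.
rewrite -big_split /=.
have -> : t = \sum_(1 <= k < n.*2.+1) (k <= t).
  rewrite (big_cat_nat (n := t.+1)) //= [X in _ = _ + X]big1_seq ?addn0.
    rewrite (eq_big_nat _ _ (F2 := fun=> 1)) ?sum_nat_const_nat; first lia.
    by move=> k; rewrite ltnS => /andP[_ ->].
  by move=> k /andP[_]; rewrite mem_index_iota; case: leqP => //; lia.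
rewrite -big_split /= big_nat_cond [X in _ <= X]big_nat_cond leq_sum // => k _.
case: (leqP k t) => [_|tk]; first by move: (leq_divDl (p ^ k) n n); rewrite addnn; lia.
by rewrite (divn_small (m := n.*2)) // (leq_trans (trunc_log_ltn _ p_gt1)) // leq_exp2l.
Qed.

(** Every prime p dividing C(2n, n) is at most 2n. If all of them were at most 2^e, there would be
    at most 2^e of them, hence 2^n <= C(2n, n) <= (2n)^(2^e). For n = 2^(2e+3) this says 8 * 2^e <=
    2e + 4, which is false. *)
Lemma prime_between_pow2 e : exists2 p, prime p & 2 ^ e < p <= 2 ^ (e.*2 + 4).
Proof.
set n := 2 ^ (e.*2 + 3).
have n2E : n.*2 = 2 ^ (e.*2 + 4) by rewrite -mul2n -expnS; congr (2 ^ _); lia.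
have n_gt0 : 0 < n by rewrite expn_gt0.
set C := 'C(n.*2, n).
have C_gt0 : 0 < C by rewrite bin_gt0 -addnn leq_addr.
case: (boolP (has (fun p => 2 ^ e < p) (primes C))) => [/hasP[p]|/hasPn small].
  rewrite mem_primes => /and3P[p_pr _ pC] ep; exists p => //; rewrite ep -n2E /=.
  apply: leq_trans (pfactor_central_bin p_pr n_gt0).
  by rewrite -{1}(expn1 p) leq_exp2l ?prime_gt1 // logn_gt0 mem_primes p_pr C_gt0.
have szC : size (primes C) <= 2 ^ e.
  rewrite -(size_iota 1 (2 ^ e)) uniq_leq_size ?primes_uniq // => p pC.
  have := small p pC; rewrite -leqNgt mem_iota add1n ltnS => ->.
  by move: pC; rewrite mem_primes => /andP[/prime_gt0 ->].
have leC : C <= n.*2 ^ size (primes C).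
  rewrite {1}(prod_prime_decomp C_gt0) prime_decompE big_map /=.
  have : all prime (primes C) by apply/allP => p; rewrite mem_primes => /andP[].
  elim: (primes C) => [|p s IHs] /=; first by rewrite big_nil.
  by case/andP=> p_pr /IHs; rewrite big_cons expnS; apply/leq_mul/pfactor_central_bin.
have := leq_trans (expn2_leq_central_bin n) leC.
have n2_gt1 : 0 < n.*2 by rewrite double_gt0.
move/leq_trans/(_ (leq_pexp2l n2_gt1 szC)); rewrite n2E -expnM leq_exp2l //.
have -> : n = 2 ^ (e + 3) * 2 ^ e by rewrite -expnD; congr (2 ^ _); lia.
rewrite leq_pmul2r ?expn_gt0 // expnD; have := ltn_expl e (ltnSn 1); lia.
Qed.

Local Open Scope ring_scope.

(** * Lower bound *)

Lemma card_word m : #|word m| = (2 ^ word_bits m)%N.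
Proof. by rewrite card_tuple card_bool. Qed.

Lemma card_memory m w : #|{: w.-tuple (word m)}| = (2 ^ (w * word_bits m))%N.
Proof. by rewrite card_tuple card_word -expnM mulnC. Qed.

Lemma card_bseq_word m h : (#|{: h.-bseq (word m)}| <= 2 * 2 ^ (h * word_bits m))%N.
Proof.
rewrite card_bseq (mulnC h) expnM -card_word.
have : (1 < #|word m|)%N by rewrite card_word -{1}(expn0 2) ltn_exp2l.
move: #|word m| => N N1.
elim: h => [|h IHh]; first by rewrite big_ord1.
rewrite big_ord_recr /= (leq_trans (leq_add IHh (leqnn _))) // expnS.
have : (2 * N ^ h <= N * N ^ h)%N by rewrite leq_mul2r N1 orbT.
by rewrite mulnC; lia.
Qed.

Lemma exists_le_average (T : finType) (g : T -> nat) N :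
  (0 < #|T|)%N -> (\sum_t g t <= #|T| * N)%N -> exists t, (g t <= N)%N.
Proof.
move=> T_gt0 le_g; case: (boolP [exists t, g t <= N]%N) => [/existsP //|].
rewrite negb_exists => /forallP gt_g.
have : (\sum_(t : T) N.+1 <= \sum_t g t)%N.
  by apply: leq_sum => t _; rewrite ltnNge gt_g.
rewrite sum_nat_const mulnS => /leq_trans/(_ le_g).
by rewrite -[X in (_ <= X)%N]add0n leq_add2r leqNgt T_gt0.
Qed.

Lemma card_exists_le (T U : finType) (Q : T -> pred U) :
  (#|[set u | [exists t, Q t u]]| <= \sum_t #|[set u | Q t u]|)%N.
Proof.
rewrite -sum1_card big_mkcond /=.
under [X in (_ <= X)%N]eq_bigr => t _ do rewrite -sum1_card big_mkcond /=.
rewrite exchange_big /= leq_sum // => u _; rewrite inE.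
by case: ifP => // /existsP[t Qtu]; rewrite (bigD1 t) //= inE Qtu.
Qed.

Section Acceptance.
Variables (I : Type) (O : eqType) (m w : nat) (V : verifier I O m w).

Lemma Pr_eq1 (P : pred (coins V)) : Pr P = 1 -> forall r, P r.
Proof.
rewrite /Pr => P1 r; have : #|P| = #|{: coins V}|.
  apply/eqP; rewrite -(eqr_nat rat) -subr_eq0.
  have nz : #|{: coins V}|%:R != 0 :> rat by rewrite pnatr_eq0 -lt0n; apply/card_gt0P; exists r.
  by rewrite -[X in X - _](divfK nz) P1 mul1r subrr.
rewrite -(cardC P) => /esym/eqP; rewrite -[X in _ == X]addn0 eqn_add2l => /eqP/card0_eq/(_ r).
by rewrite !inE => /negbFE.
Qed.

Lemma Pr_le_third (P : pred (coins V)) :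
  Pr P <= 1 / 3%:R -> (3 * #|P| <= #|{: coins V}|)%N.
Proof.
rewrite /Pr; have [c0 _|c_gt0] := posnP #|{: coins V}|.
  by have := max_card P; rewrite c0 leqn0 => /eqP ->; rewrite muln0.
by rewrite ler_pdivrMr ?ltr0n // mulrAC ler_pdivlMr ?ltr0n // mul1r -natrM ler_nat mulnC.
Qed.

End Acceptance.

Section Amplification.
Variables (I : Type) (O : eqType) (m w h k0 : nat) (V : verifier I O m w).
Variables (f : seq I -> seq O) (S : seq I -> Prop).
Variables (X Y : finType) (pre : X -> seq I) (suf : Y -> seq I).

Local Notation str x y := (pre x ++ suf y).
Local Notation k := (h * word_bits m + k0)%N.

(* Run k independent copies of the verifier: by a union bound over all the
   annotations of length at most h, for most coins every annotation that all
   copies accept is a valid one, so the verifier needs no helper. *)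
Lemma amplified_verifier : (0 < k0)%N ->
  (forall x y, S (str x y)) ->
  (0 < #|{: coins V}|)%N ->
  valid_protocol V f S -> help_cost_le V f S h ->
  exists (enc : X -> {ffun 'I_k -> w.-tuple (word m)}) (bad : X -> {set Y}),
    (3 ^ k0 * \sum_x #|bad x| <= 2 * (#|X| * #|Y|))%N /\
    forall x x' y, enc x = enc x' -> y \notin bad x -> y \notin bad x' ->
      f (str x y) = f (str x' y).
Proof.
move=> k0_gt0 SS coins_gt0 [_ soundV] [H validH].
pose valid a s := [forall r : coins V, output r s a == Some (f s)].
pose acc a s := [pred r : coins V | output r s a != None].
pose passes (rs : {ffun 'I_k -> coins V}) a s := [forall i, acc a s (rs i)].
pose bad rs x := [set y | [exists a : h.-bseq (word m),
                     ~~ valid a (str x y) && passes rs a (str x y)]].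
(* Soundness speaks of helpers; the constant helper turns it into a bound for a single
   annotation. *)
have acc_ub a x y : ~~ valid a (str x y) -> (3 * #|acc a (str x y)| <= #|{: coins V}|)%N.
  move=> inv; case: (soundV (fun=> a) _ (SS x y)) => [/Pr_eq1 v|/Pr_le_third //].
  by case/negP: inv; apply/forallP.
have pass_ub a x y : ~~ valid a (str x y) ->
    (3 ^ k * #|[set rs | passes rs a (str x y)]| <= #|{: coins V}| ^ k)%N.
  move=> /acc_ub acc3.
  have -> : #|[set rs | passes rs a (str x y)]| = (#|acc a (str x y)| ^ k)%N.
    rewrite -[in RHS](card_ord k) -card_ffun_on; apply: eq_card => rs.
    by rewrite inE; apply/forallP/ffun_onP.
  by rewrite -expnMn leq_exp2r // addn_gt0 k0_gt0 orbT.
(* There are at most 2 * 2^(h * word_bits m) annotations, and an invalid one passes all [k] copies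
   on a fraction 3^-k of the coins. The first h * word_bits m copies pay for the union bound; the
   other [k0] leave the error 2 * 3^-k0. *)
have bad_ub x y : (3 ^ k0 * #|[set rs | y \in bad rs x]| <= 2 * #|{: coins V}| ^ k)%N.
  have pow_gt0 : (0 < 3 ^ (h * word_bits m))%N by rewrite expn_gt0.
  rewrite -(leq_pmul2l pow_gt0) mulnA -expnD.
  under eq_finset => rs do rewrite inE.
  apply: leq_trans (leq_mul (leqnn _) (card_exists_le _)) _.
  rewrite big_distrr /=.
  have : (\sum_(a : h.-bseq (word m)) #|{: coins V}| ^ k <=
            3 ^ (h * word_bits m) * (2 * #|{: coins V}| ^ k))%N.
    rewrite sum_nat_const mulnA leq_mul // (leq_trans (card_bseq_word m h)) //.
    by rewrite mulnC leq_mul //; case: (h * _)%N => // n; rewrite leq_exp2r.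
  apply: leq_trans; apply: leq_sum => a _.
  case: (boolP (valid a (str x y))) => [v|/[dup] /pass_ub ub inv].
    by rewrite (eq_card0 (A := [set _ | _])) ?muln0 // => rs; rewrite !inE.
  exact: ub.
(* Averaging fixes the coins, after which the memory contents are a deterministic code of [x]. *)
have [rs le_rs] : exists rs, (3 ^ k0 * \sum_x #|bad rs x| <= 2 * (#|X| * #|Y|))%N.
  apply: exists_le_average; first by rewrite card_ffun card_ord expn_gt0 coins_gt0.
  rewrite -big_distrr /=.
  have -> : (\sum_rs \sum_x #|bad rs x| = \sum_x \sum_y #|[set rs | y \in bad rs x]|)%N.
    rewrite exchange_big /=; apply: eq_bigr => x _.
    under eq_bigr => rs _ do rewrite -sum1_card big_mkcond /=.
    rewrite exchange_big /=; apply: eq_bigr => y _.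
    by rewrite -sum1_card [RHS]big_mkcond /=; apply: eq_bigr => rs _; rewrite !inE.
  have : (\sum_(x : X) \sum_(y : Y) 2 * #|{: coins V}| ^ k <=
            #|{: {ffun 'I_k -> coins V}}| * (2 * (#|X| * #|Y|)))%N.
    by rewrite !sum_nat_const card_ffun card_ord mulnA mulnC (mulnC 2) -mulnA.
  apply: leq_trans; rewrite big_distrr leq_sum // => x _.
  by rewrite big_distrr leq_sum.
pose enc x := [ffun i => foldl (read_item (rs i)) (start (rs i)) (pre x)].
exists enc, (bad rs); split=> // x x' y enc_eq.
(* Give the honest annotation for [x] and [y] to the copies that read [x']. Their states agree, so
   all of them output the value for [x]; as [y] is not bad for [x'], that annotation is valid there,
   and the value is also the one for [x']. *)
have [Hv Hsz] := validH _ (SS x y).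
set a0 := H _ in Hv Hsz.
have Ha : (size a0 <= h)%N := Hsz.
rewrite !inE !negb_exists => _ /forallP /(_ (Bseq Ha)) /=.
have outE i : output (rs i) (str x' y) a0 = Some (f (str x y)).
  have /ffunP/(_ i) := enc_eq; rewrite !ffunE => eq_mem.
  by have /eqP <- := Pr_eq1 Hv (rs i); rewrite /output !foldl_cat eq_mem.
have -> : passes rs a0 (str x' y) by apply/forallP => i; rewrite /= outE.
rewrite andbT negbK => /forallP v.
have k_gt0 : (0 < k)%N by rewrite addn_gt0 k0_gt0 orbT.
by have := v (rs (Ordinal k_gt0)); rewrite outE => /eqP[].
Qed.
End Amplification.

(** * Hard streams and the counting argument *)

Section HardStreams.
Variables (b c : nat) (P : {set 'I_b * 'I_c}).

(** [A] selects the positive signs. Both signs are nonzero, so the density of the matrix depends on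
    [P] alone, and [A] has no effect outside [P]. *)
Definition sign_items (A : {set 'I_b * 'I_c}) : seq (mv_item b c) :=
  [seq (inl q : mv_index b c, if q \in A then 1 else -1) | q <- enum P].

(** The zeros are sent explicitly, so that the length of the stream does not depend on [A] or
    [j]. *)
Definition unit_items (j : 'I_c) : seq (mv_item b c) :=
  [seq (inr k : mv_index b c, (k == j)%:R) | k <- enum 'I_c].

Local Notation str A j := (sign_items A ++ unit_items j).

Lemma entry_sign_unit_inl A j q :
  entry (str A j) (inl q) = if q \in P then (if q \in A then 1 else -1) else 0.
Proof.
rewrite /entry big_cat /= !big_map [X in _ + X]big1 ?addr0 => [|k /eqP //].
rewrite big_enum_cond /=.
under eq_bigl => k do rewrite /= (inj_eq inl_inj) andbC.
by rewrite big_mkcondr big_pred1_eq.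
Qed.

Lemma entry_sign_unit_inr A j k : entry (str A j) (inr k) = (k == j)%:R.
Proof.
rewrite /entry big_cat /= !big_map [X in X + _]big1 ?add0r => [|q /eqP //].
by rewrite (big_pred1 k) // => i; rewrite /= (inj_eq inr_inj).
Qed.

(** Multiplying by a unit vector reads off one column of signs. *)
Lemma mv_product_sign_unit A A' j :
  mv_product (str A j) = mv_product (str A' j) ->
  forall i, (i, j) \in P -> ((i, j) \in A) = ((i, j) \in A').
Proof.
have E B i : (stream_matrix (str B j) *m stream_vector (str B j)) i 0 =
    if (i, j) \in P then (if (i, j) \in B then 1 else -1) else 0.
  rewrite mxE (bigD1 j) //= big1 ?addr0 => [|k kj].
    by rewrite !mxE entry_sign_unit_inl entry_sign_unit_inr eqxx mulr1.
  by rewrite !mxE entry_sign_unit_inr (negPf kj) mulr0.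
rewrite /mv_product => /eq_in_map eqAA' i ijP.
by have := eqAA' i (mem_enum _ _); rewrite !E ijP; do 2 case: (_ \in _).
Qed.

Lemma mv_stream_sign_unit m kappa A j : (#|P| + c)%N = m ->
  mv_stream m kappa (str A j).
Proof.
move=> mE; have m_gt0 : (0 < m)%N by rewrite -mE ltn_addl // (leq_ltn_trans _ (ltn_ord j)).
split.
- by rewrite size_cat 2!size_map -cardE size_enum_ord.
- rewrite map_cat /sign_items /unit_items -(map_comp _ _ (enum P)) -(map_comp _ _ (enum 'I_c)).
  rewrite cat_uniq !(map_inj_uniq (f := _ \o _)) ?enum_uniq; first last.
  + by move=> k k' [].
  + by move=> k k' [].
  by rewrite andbT; apply/hasPn => _ /mapP[k _ ->]; apply/mapP => -[q _].
- have m1 : (1 <= m ^ kappa)%N by rewrite expn_gt0 m_gt0.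
  move=> p; rewrite mem_cat => /orP[] /mapP[q _ ->] /=; first by case: ifP.
  by case: eqP.
Qed.

Lemma dense_sign_unit (R : realType) (delta : R) A j :
  delta * b%:R * c%:R <= #|P|%:R ->
  dense delta (stream_matrix (str A j)).
Proof.
rewrite /dense => /le_trans; apply; rewrite ler_nat subset_leq_card //.
apply/subsetP => -[i k] ikP; rewrite inE mxE entry_sign_unit_inl ikP.
by case: ifP.
Qed.

End HardStreams.

(* A matrix with few bad columns is determined by the code, the set of bad
   columns, and its own entries in the bad columns and outside of P. *)
Lemma card_few_bad_columns (b c E : nat) (P : {set 'I_b * 'I_c}) (T : finType)
    (enc : {set 'I_b * 'I_c} -> T) (bad : {set 'I_b * 'I_c} -> {set 'I_c}) :
  (forall A A' j, enc A = enc A' -> j \notin bad A -> j \notin bad A' ->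
     forall i, (i, j) \in P -> ((i, j) \in A) = ((i, j) \in A')) ->
  (#|[set A | #|bad A| <= E]| <= #|T| * 2 ^ c * 2 ^ (b * E + (b * c - #|P|)))%N.
Proof.
move=> decode; set good := [set A | _].
pose code A := (enc A, bad A).
have -> : #|good| = (\sum_(z : T * {set 'I_c}) #|[set A in good | code A == z]|)%N.
  rewrite -sum1_card (partition_big code predT) //=; apply: eq_bigr => z _.
  by rewrite -sum1_card; apply: eq_bigl => A; rewrite !inE.
have : (\sum_(z : T * {set 'I_c}) 2 ^ (b * E + (b * c - #|P|)) <=
        #|T| * 2 ^ c * 2 ^ (b * E + (b * c - #|P|)))%N.
  by rewrite sum_nat_const card_prod -(cardsT {set 'I_c}) -powersetT card_powerset cardsT card_ord.
apply: leq_trans; apply: leq_sum => -[t J] _.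
have [->|[A0]] := set_0Vmem [set A in good | code A == (t, J)].
  by rewrite cards0.
rewrite !inE => /andP[+ /eqP[_ bA0]]; rewrite bA0 => leJE.
(* On a fibre of the code, columns outside [J] are decoded on [P], so only the positions in [U]
   remain free. *)
pose U := setX [set: 'I_b] J :|: ~: P.
have injU : {in [set A in good | code A == (t, J)] &, injective (fun A => A :&: U)}.
  move=> A A'; rewrite !inE => /andP[_ /eqP[eA bA]] /andP[_ /eqP[eA' bA']] eqU.
  apply/setP => -[i j]; have /setP/(_ (i, j)) := eqU; rewrite !inE /=.
  case: (boolP (j \in J)) => jJ /=; first by rewrite !andbT.
  case: (boolP (_ \in P)) => [ijP _ /=|_ /=]; last by rewrite !andbT.
  by apply: decode; rewrite ?eA ?eA' ?bA ?bA'.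
rewrite -(card_in_imset injU); apply: (@leq_trans #|powerset U|).
  by apply/subset_leq_card/subsetP => _ /imsetP[A _ ->]; rewrite inE subsetIr.
rewrite card_powerset leq_exp2l //.
rewrite (leq_trans (leq_card_setU _ _)) // leq_add //.
  by rewrite cardsX cardsT card_ord leq_mul2l leJE orbT.
by rewrite cardsCs setCK card_prod !card_ord.
Qed.

Lemma markov_card (T : finType) (g : T -> nat) E :
  (E.+1 * #|[set t | E < g t]| <= \sum_t g t)%N.
Proof.
rewrite -sum1_card big_distrr /= [X in (_ <= X)%N](bigID (fun t => E < g t)%N) /=.
rewrite (leq_trans _ (leq_addr _ _)) //.
rewrite (eq_bigl (fun t => E < g t)%N) => [|t]; last by rewrite inE.
by apply: leq_sum => t; rewrite muln1.
Qed.

Lemma valid_helper_coins_gt0 (I : Type) (O : eqType) (m w : nat)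
    (V : verifier I O m w) (f : seq I -> seq O) (H : helper I m) (s : seq I) :
  valid_helper V f H s -> (0 < #|{: coins V}|)%N.
Proof.
rewrite lt0n => v; apply/eqP => c0; move: v; rewrite /valid_helper /Pr c0 invr0 mulr0.
by move/eqP; rewrite eq_sym oner_eq0.
Qed.

(* If nothing is remembered of the stream, the honest annotation for one matrix
   is accepted with the same output when an entry is negated. *)
Lemma memory_gt0 (I : Type) (O : eqType) (m w n : nat) (V : verifier I O m w)
    (f : seq I -> seq O) (S : seq I -> Prop) (u u' v : seq I) :
  valid_protocol V f S -> help_cost_le V f S n ->
  S (u ++ v) -> S (u' ++ v) -> f (u ++ v) <> f (u' ++ v) -> (0 < w)%N.
Proof.
move=> [_ soundV] [H validH] Su Su'; case: w V soundV H validH => // V soundV H validH.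
have [/[dup] vP /Pr_eq1 v1 _] := validH _ Su.
have out (r : coins V) : output r (u' ++ v) (H (u ++ v)) = Some (f (u ++ v)).
  by have /eqP <- := v1 r; rewrite /output !foldl_cat !(tuple0 (foldl _ (start r) _)).
have coins_gt0 := valid_helper_coins_gt0 vP.
have [r0 _] : exists r : coins V, true by case/card_gt0P: coins_gt0 => r _; exists r.
case: (soundV (fun=> H (u ++ v)) _ Su') => [/Pr_eq1/(_ r0)|/Pr_le_third].
  by rewrite /= out => /eqP[].
rewrite (eq_card (B := coins V)) => [|r]; last by rewrite !inE out.
by rewrite leqNgt ltn_Pmull.
Qed.

Lemma subset_of_card (T : finType) n : (n <= #|T|)%N -> exists P : {set T}, #|P| = n.
Proof.
move=> nT; exists [set x in take n (enum T)].
by rewrite cardsE (card_uniqP _) ?take_uniq ?enum_uniq // size_takel // -cardT.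
Qed.

Lemma mv_lower_bound (R : realType) (kappa : nat) (delta : R) : 0 < delta <= 1 ->
  exists2 K : R, 0 < K & forall b c m : nat,
     (0 < b)%N -> (0 < c)%N ->
     delta * b%:R * c%:R + c%:R <= m%:R -> (m <= b * c + c)%N ->
     forall (w : nat) (V : verifier (mv_item b c) int m w) (h : nat),
       valid_protocol V (@mv_product b c)
         (@dense_mv_stream b c R delta m kappa) ->
       help_cost V (@mv_product b c)
         (@dense_mv_stream b c R delta m kappa) h ->
       K * (minn c b ^ 2)%:R <=
         (maxn (h * word_bits m) 1)%:R * (w * word_bits m)%:R.
Proof.
move=> /andP[delta_gt0 _].
(* With error 2 * 3^-k0, Markov's inequality at a threshold of about delta c / 4 bad columns must
   leave at least half of the matrices; this needs 3^k0 >= 16 / delta. *)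
have [k0 k0_gt0 k0E] : exists2 k0, (0 < k0)%N & 16 / delta <= (3 ^ k0)%:R.
  exists (Num.truncn (16 / delta)).+1 => //.
  apply: le_trans (ltW (truncnS_gt _)) _.
  by rewrite ler_nat ltnW // ltn_expl.
exists (Num.min (delta / (2 * k0.+1%:R)) (delta ^+ 2 / 64)).
  by rewrite lt_min !divr_gt0 ?mulr_gt0 ?exprn_gt0 ?ltr0n.
move=> b c m b_gt0 c_gt0 le_m m_ub w V h validV [costV _].
have c_le_m : (c <= m)%N.
  rewrite -(ler_nat R); apply: le_trans le_m; rewrite lerDr.
  by rewrite !mulr_ge0 // ltW.
have [P cardP] : exists P : {set 'I_b * 'I_c}, #|P| = (m - c)%N.
  by apply: subset_of_card; rewrite card_prod !card_ord; lia.
have mE : (#|P| + c)%N = m by rewrite cardP subnK.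
have denseP : delta * b%:R * c%:R <= #|P|%:R by rewrite -mE natrD lerD2r in le_m.
pose str A j := sign_items P A ++ unit_items b j.
have Sstr A j : dense_mv_stream delta m kappa (str A j).
  by split; [exact: mv_stream_sign_unit | exact: dense_sign_unit].
have P_gt0 : (0 < #|P|)%N.
  rewrite -(ltr0n R); apply: lt_le_trans denseP; by rewrite !mulr_gt0 ?ltr0n.
have w_gt0 : (0 < w)%N.
  have /card_gt0P[[i j] ijP] := P_gt0.
  apply: (memory_gt0 validV costV (Sstr P j) (Sstr set0 j)).
  by move/mv_product_sign_unit/(_ i ijP); rewrite ijP inE.
have wb_gt0 : (0 < w * word_bits m)%N by rewrite muln_gt0 w_gt0.
set H := maxn _ _; set W := (w * word_bits m)%N in wb_gt0 *.
have H_gt0 : (0 < H)%N by rewrite leq_max orbT.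
set K := Num.min _ _.
have K_gt0 : 0 < K.
  by rewrite lt_min !divr_gt0 ?mulr_gt0 ?exprn_gt0 ?ltr0n.
have K1 : K <= delta / (2 * k0.+1%:R) by rewrite ge_min lexx.
have K2 : K <= delta ^+ 2 / 64 by rewrite ge_min lexx orbT.
(* For bounded [b] the second term of the minimum [K] brings the left side down to at most 1, and
   nonempty memory suffices. For large [b] the first term is used with the counting bound. *)
have [b_small|b_big] := ltP b%:R (8 / delta).
  have HW1 : 1 <= H%:R * W%:R :> R by rewrite -natrM ler1n muln_gt0 H_gt0.
  apply: le_trans HW1.
  have min_ub : (minn c b ^ 2)%:R <= (8 / delta) ^+ 2.
    rewrite natrX ler_pXn2r ?nnegrE ?divr_ge0 ?(ltW delta_gt0) //.
    by apply: le_trans (ltW b_small); rewrite ler_nat geq_minr.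
  apply: le_trans (ler_pM (ltW K_gt0) _ K2 min_ub) _ => //.
  suff -> : delta ^+ 2 / 64 * (8 / delta) ^+ 2 = 1 by [].
  by field; rewrite gt_eqF.
have coins_gt0 : (0 < #|{: coins V}|)%N.
  have [Hv /(_ _ (Sstr P (Ordinal c_gt0)))[vH _]] := costV.
  exact: valid_helper_coins_gt0 vH.
have [enc [bad [bad_ub decode]]] :=
  amplified_verifier k0_gt0 Sstr coins_gt0 validV costV.
set k := (h * word_bits m + k0)%N in enc bad_ub decode.
set E := Num.truncn (delta * c%:R / 4).
have few := @card_few_bad_columns b c E P _ enc bad
   (fun A A' j e bA bA' i => mv_product_sign_unit (decode A A' j e bA bA') (i := i)).
have markov := markov_card (fun A => #|bad A|) E.
have card_mat : #|{: {set 'I_b * 'I_c}}| = (2 ^ (b * c))%N.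
  by rewrite -cardsT -powersetT card_powerset cardsT card_prod !card_ord.
have half : (2 ^ (b * c) <= 2 * #|[set A | #|bad A| <= E]|)%N.
  have split_card : (2 ^ (b * c) =
      #|[set A | #|bad A| <= E]| + #|[set A | E < #|bad A|]|)%N.
    rewrite -card_mat -(cardsC [set A | #|bad A| <= E]%N); congr (_ + _)%N.
    by apply: eq_card => A; rewrite !inE ltnNge.
  have E_lb : (4 * c <= 3 ^ k0 * E.+1)%N.
    rewrite -(ler_nat R) !natrM.
    have -> : 4 * c%:R = 16 / delta * (delta * c%:R / 4) :> R by field; rewrite gt_eqF.
    rewrite ler_pM ?divr_ge0 ?mulr_ge0 ?(ltW delta_gt0) //.
    exact/ltW/truncnS_gt.
  rewrite card_mat card_ord in bad_ub.
  move: bad_ub markov E_lb split_card.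
  set B := #|[set A | E < #|bad A|]|%N; set G := #|[set A | #|bad A| <= E]|%N.
  set S := (\sum_A _)%N.
  move: (2 ^ _)%N (3 ^ _)%N => X Y bad_ub markov E_lb split_card.
  suff : (2 * B <= X)%N by lia.
  have : (4 * c * B <= Y * E.+1 * B)%N by rewrite leq_mul2r E_lb orbT.
  have : (Y * (E.+1 * B) <= Y * S)%N by rewrite leq_mul2l markov orbT.
  nia.
(* At least half of the 2^(bc) matrices have few bad columns, so 2^(bc) <= 2 * 2^(kW) * 2^c * 2^(bE
   + bc - |P|); compare exponents. *)
have main : (#|P| <= 1 + k * W + c + b * E)%N.
  have := leq_trans half (leq_mul (leqnn 2) few).
  rewrite card_ffun card_memory card_ord -expnM -!expnD -expnS leq_exp2l //.
  have : (#|P| <= b * c)%N by rewrite -[b in leqRHS]card_ord -[c in leqRHS]card_ord -card_prod max_card.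
  rewrite (mulnC k); lia.
have mainR : #|P|%:R <= 1 + k%:R * W%:R + c%:R + b%:R * E%:R :> R.
  by rewrite -!natrM -(natrD _ 1) -!natrD ler_nat.
have E_ub : E%:R <= delta * c%:R / 4.
  by rewrite truncn_le // divr_ge0 ?mulr_ge0 // ltW.
have k_ub : (k%:R <= k0.+1%:R * H%:R :> R).
  rewrite -natrM ler_nat /k mulSn leq_add ?leq_maxl //; nia.
have min_ub : ((minn c b ^ 2)%:R <= b%:R * c%:R :> R).
  by rewrite -natrM ler_nat mulnC -mulnn leq_mul ?geq_minl ?geq_minr.
apply: le_trans (ler_pM (ltW K_gt0) _ K1 min_ub) _ => //.
have -> : delta / (2 * k0.+1%:R) * (b%:R * c%:R) = delta * b%:R * c%:R / 2 / k0.+1%:R.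
  have : k0.+1%:R != 0 :> R by rewrite pnatr_eq0.
  by move: k0.+1%:R => q q0; field.
rewrite ler_pdivrMr ?ltr0n //.
(* Both 1 + c <= 2c and bE are at most delta bc / 4, while |P| >= delta bc, so kW >= delta bc /
   2. *)
have c_ge1 : 1 <= c%:R :> R by rewrite ler1n.
have db : 8 * c%:R <= delta * b%:R * c%:R.
  rewrite ler_pM2r ?ltr0n //.
  by move: b_big; rewrite ler_pdivrMr // mulrC.
have bE : b%:R * E%:R <= delta * b%:R * c%:R / 4.
  apply: le_trans (ler_wpM2l (ler0n _ b) E_ub) _.
  by rewrite !mulrA (mulrC b%:R).
have kW : k%:R * W%:R <= H%:R * W%:R * k0.+1%:R :> R.
  by rewrite mulrAC (mulrC H%:R) ler_wpM2r.
lra.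
Qed.

(** * Arithmetic in the prime field *)

(** The representative of least absolute value, so that negative entries of the product are
    recovered too. *)
Definition int_of_Fp p (x : 'F_p) : int :=
  if (2 * x < p)%N then x%:Z else x%:Z - p%:Z.

Lemma int_of_FpK p (z : int) : prime p -> (2 * `|z| < p)%N ->
  int_of_Fp (z%:~R : 'F_p) = z.
Proof.
move=> p_pr; rewrite /int_of_Fp; case: z => n z_lt.
  by rewrite -pmulrn val_Fp_nat // modn_small ?z_lt //; move: z_lt; rewrite absz_nat; lia.
move: z_lt; rewrite NegzE abszN absz_nat => n_lt.
have -> : (- n.+1%:Z)%:~R = (p - n.+1)%:R :> 'F_p.
  by rewrite natrB ?mulrNz ?pchar_Fp_0 ?sub0r -?pmulrn //; lia.
by rewrite val_Fp_nat // modn_small; [case: ifP |]; lia.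
Qed.

Lemma sum_digits N t x : (0 < N)%N -> (x < N ^ t)%N ->
  (\sum_(l < t) (x %/ N ^ l %% N) * N ^ l)%N = x.
Proof.
move=> N_gt0 x_lt; rewrite -[RHS](modn_small x_lt) => {x_lt}.
elim: t => [|t IHt]; first by rewrite big_ord0 modn1.
rewrite big_ord_recr /= IHt; set q := (x %/ N ^ t)%N.
rewrite [in RHS](divn_eq x (N ^ t)) -/q {2}(divn_eq q N) mulnDl -mulnA -expnS -addnA.
rewrite modnMDl [RHS]modn_small; first by rewrite addnC.
have := ltn_pmod q N_gt0; have : (x %% N ^ t < N ^ t)%N by rewrite ltn_pmod // expn_gt0 N_gt0.
rewrite expnS; move: (N ^ t)%N (x %% _)%N (q %% N)%N => M r d rM dN.
have : (d.+1 * M <= N * M)%N by rewrite leq_mul2r dN orbT.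
by rewrite mulSn; lia.
Qed.

Lemma card_roots_leq (F : finFieldType) (q : {poly F}) : q != 0 ->
  (#|[set x | root q x]| <= size q)%N.
Proof.
move=> q0; rewrite cardE ltnW // max_poly_roots ?enum_uniq //.
by apply/allP => x; rewrite mem_enum inE.
Qed.

(** A Schwartz-Zippel count. At most [D] values r are roots of [U i0], and each admits at most |F|
    values rho. For any other r the sum is a nonzero polynomial in rho with at most [b]
    coefficients, hence at most [b] roots. *)
Lemma card_common_roots_leq (F : finFieldType) (b D : nat) (U : nat -> {poly F}) (i0 : 'I_b) :
  U i0 != 0 -> (size (U i0) <= D)%N ->
  (#|[set z : F * F | (\sum_(i < b) z.1 ^+ i * (U i).[z.2] == 0)%R]| <= #|F| * (D + b))%N.
Proof.
move=> U0 szU; set Z := [set z | _].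
have -> : #|Z| = (\sum_(r : F) #|[set rho | (rho, r) \in Z]|)%N.
  rewrite -sum1_card (partition_big snd predT) //=; apply: eq_bigr => r _.
  rewrite -sum1_card (reindex_onto (fun rho => (rho, r)) fst) /=; last first.
    by move=> [rho r'] /= /andP[_ /eqP ->].
  by apply: eq_bigl => rho; rewrite !inE !eqxx !andbT.
apply: (@leq_trans (\sum_(r : F) (b + if root (U i0) r then #|F| else 0))%N).
  apply: leq_sum => r _; case: ifP => [_|/negbT Ur].
    by rewrite (leq_trans (max_card _)) // leq_addl.
  pose q := \poly_(i < b) (U i).[r].
  have q0 : q != 0.
    apply: contra Ur => /eqP q0; have := congr1 (fun q : {poly F} => q`_i0) q0.
    by rewrite coef_poly ltn_ord coef0 /root => ->.
  rewrite addn0 (leq_trans _ (size_poly b (fun i => (U i).[r]))) //.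
  apply: leq_trans (card_roots_leq q0); rewrite subset_leq_card //.
  apply/subsetP => rho; rewrite !inE /root horner_poly /= => /eqP sum0.
  by apply/eqP; rewrite -[RHS]sum0; apply: eq_bigr => i _; rewrite mulrC.
rewrite big_split /= sum_nat_const -big_mkcond /= sum_nat_const.
rewrite addnC mulnDr leq_add2r mulnC leq_mul2l (leq_trans _ szU) ?orbT //.
by have := card_roots_leq U0; rewrite cardsE.
Qed.

(** * Row polynomials encoding inner products *)

Section RowPolynomial.
Variables (F : comNzRingType) (c C v : nat).
Hypothesis c_ub : (c <= C * v)%N.

(* The index j is the pair (j %/ v, j %% v).  As the exponents of one factor
   increase and those of the other decrease with j %/ v, the coefficient of
   'X^(C.-1) of the product is the inner product. *)
Definition row_poly (a x : 'I_c -> F) : {poly F} :=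
  \sum_(y < v) (\sum_(j < c | (j %% v == y)%N) a j *: 'X^(j %/ v)%N) *
               (\sum_(j < c | (j %% v == y)%N) x j *: 'X^(C.-1 - j %/ v)%N).

Lemma ltn_col_div (j : 'I_c) : (j %/ v < C)%N.
Proof.
have v_gt0 : (0 < v)%N by case: v c_ub (ltn_ord j) => //; rewrite muln0; lia.
by rewrite ltn_divLR // (leq_trans (ltn_ord j)).
Qed.

Lemma size_row_poly a x : (size (row_poly a x) <= (C + C).-1)%N.
Proof.
apply: leq_trans (size_sum _ _ _) _; apply/bigmax_leqP => y _.
have size_le (g : 'I_c -> F) (e : 'I_c -> nat) : (forall j, e j < C)%N ->
    (size (\sum_(j < c | (j %% v == y)%N) g j *: 'X^(e j))%R <= C)%N.
  move=> e_lt; apply: leq_trans (size_sum _ _ _) _; apply/bigmax_leqP => j _.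
  by apply: leq_trans (size_scale_leq _ _) _; rewrite size_polyXn.
apply: leq_trans (size_polyMleq _ _) _; rewrite -!subn1 leq_sub2r // leq_add // size_le // => j.
  exact: ltn_col_div.
by move: (ltn_col_div j); move: (j %/ v)%N => d; lia.
Qed.

Lemma coef_row_poly a x : (row_poly a x)`_C.-1 = \sum_j a j * x j.
Proof.
rewrite coef_sum.
transitivity (\sum_(y < v) \sum_(j < c | (j %% v == y)%N) a j * x j).
  apply: eq_bigr => y _; rewrite mulr_suml coef_sum; apply: eq_bigr => j jy.
  rewrite mulr_sumr coef_sum (bigD1 j) //= big1 => [|j' /andP[j'y j'j]].
    rewrite addr0 -scalerAl -scalerAr -exprD !coefZ coefXn subnKC ?eqxx ?mulr1 //.
    by have := ltn_col_div j; lia.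
  rewrite -scalerAl -scalerAr -exprD !coefZ coefXn.
  case: eqP => [eq_exp|]; last by rewrite !mulr0.
  (* Quotients are below [C], so the truncated subtractions are exact and equal exponents force
     equal quotients; the remainders are both [y]. *)
  have eq_div : (j %/ v = j' %/ v)%N.
    by have := ltn_col_div j; have := ltn_col_div j'; lia.
  case/eqP: j'j; apply/val_inj; rewrite /= (divn_eq j' v) (divn_eq j v) eq_div.
  by rewrite (eqP jy) (eqP j'y).
rewrite (exchange_big_dep xpredT) //=; apply: eq_bigr => j _.
have v_gt0 : (0 < v)%N by case: v c_ub (ltn_ord j) => //; rewrite muln0; lia.
by rewrite (big_pred1 (Ordinal (ltn_pmod j v_gt0))) // => y; rewrite eq_sym.
Qed.

Lemma horner_row_poly a x r : (row_poly a x).[r] =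
  \sum_(y < v) (\sum_(j < c | (j %% v == y)%N) a j * r ^+ (j %/ v)) *
               (\sum_(j < c | (j %% v == y)%N) x j * r ^+ (C.-1 - j %/ v)).
Proof.
rewrite horner_sum; apply: eq_bigr => y _; rewrite hornerM !horner_sum.
by congr (_ * _); apply: eq_bigr => j _; rewrite hornerZ hornerXn.
Qed.

End RowPolynomial.

(** * The protocol *)

(** This lets a verifier be written over any finite type of states; fitting it into memory is then a
    matter of cardinality. *)
Lemma card_leq_cancel (A B : finType) (a0 : A) : (#|A| <= #|B|)%N ->
  exists (f : A -> B) (g : B -> A), cancel f g.
Proof.
move=> le_AB; pose f a := enum_val (widen_ord le_AB (enum_rank a)) : B.
have f_inj : injective f.
  by move=> a a' /enum_val_inj [] /val_inj /enum_rank_inj.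
exists f, (fun t => odflt a0 [pick a | f a == t]) => a.
by case: pickP => [a' /eqP/f_inj|/(_ a)/eqP].
Qed.

Section Machine.
Variables (I : Type) (O : eqType) (m w : nat) (R St : finType).
Variables (enc : St -> w.-tuple (word m)) (dec : w.-tuple (word m) -> St).
Hypothesis encK : cancel enc dec.
Variables (init : R -> St) (item : St -> I -> St).
Variables (next : St -> word m -> St * seq O) (fin : St -> option (seq O)).

(** The coins enter through [init] only, so whatever is used of them later is stored in the state
    and charged to memory. *)
Definition machine_verifier : verifier I O m w :=
  @Verifier I O m w R (enc \o init)
    (fun _ mem p => enc (item (dec mem) p))
    (fun _ mem u => let: (s, o) := next (dec mem) u in (enc s, o))
    (fun _ mem => fin (dec mem)).

Lemma machine_coins_in_memory : coins_in_memory machine_verifier.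
Proof. by []. Qed.

Definition machine_step (so : St * seq O) (u : word m) : St * seq O :=
  let: (s, o) := next so.1 u in (s, so.2 ++ o).

Lemma machine_output r s a :
  output (V := machine_verifier) r s a =
  let: so := foldl machine_step (foldl item (init r) s, [::]) a in
  omap (cat so.2) (fin so.1).
Proof.
have items st : foldl (read_item (v := machine_verifier) r) (enc st) s =
                enc (foldl item st s).
  by elim: s st => //= p s IHs st; rewrite encK IHs.
rewrite /output /= items.
have words st pre : omap (cat pre) (read_annotation (V := machine_verifier) r (enc st) a) =
    let: so := foldl machine_step (st, pre) a in omap (cat so.2) (fin so.1).
  elim: a st pre => [|u a IHa] st pre /=; first by rewrite encK.
  rewrite encK /machine_step /=; case: (next st u) => st' o; rewrite -IHa.
  by case: (read_annotation _ _) => //= out; rewrite catA.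
by rewrite -words; case: (read_annotation _ _).
Qed.

End Machine.

Section Sketch.
Variables (F : comNzRingType) (b c C v : nat).

(* Cells flagged [true] sketch A, cells flagged [false] sketch x; z is (rho, r). *)
Definition weight (z : F * F) (y : bool * 'I_v) (k : mv_index b c) : F :=
  match k with
  | inl (i, j) => (z.1 ^+ i * z.2 ^+ (j %/ v)) *+ (y.1 && (j %% v == y.2)%N)
  | inr j => z.2 ^+ (C.-1 - j %/ v) *+ (~~ y.1 && (j %% v == y.2)%N)
  end.

Definition sketch (s : seq (mv_item b c)) z y : F :=
  \sum_(p <- s) p.2%:~R * weight z y p.1.

(** By linearity a sketch depends on the entries and not on their order of arrival. *)
Lemma sketchE s z y :
  sketch s z y = \sum_(k : mv_index b c) (entry s k)%:~R * weight z y k.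
Proof.
rewrite /sketch (partition_big (fun p => p.1) predT) //=; apply: eq_bigr => k _.
rewrite /entry rmorph_sum mulr_suml; apply: eq_bigr => p /eqP -> //.
Qed.

(** The sketch of x is common to all rows, so one dot product evaluates the combination of all row
    polynomials with weights rho^i. *)
Lemma sketch_dot s z :
  \sum_(y < v) sketch s z (true, y) * sketch s z (false, y) =
  \sum_(i < b) z.1 ^+ i *
     (row_poly C v (fun j => (entry s (inl (i, j)))%:~R)
                   (fun j => (entry s (inr j))%:~R)).[z.2].
Proof.
under [RHS]eq_bigr => i _ do rewrite horner_row_poly big_distrr /=.
rewrite exchange_big /=; apply: eq_bigr => y _.
under [RHS]eq_bigr => i _ do rewrite mulrA.
rewrite -mulr_suml; congr (_ * _).
  rewrite sketchE big_sumType /= [X in _ + X]big1 ?addr0 => [|j _]; last by rewrite mulr0.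
  transitivity (\sum_(i < b) \sum_(j < c)
      (entry s (inl (i, j)))%:~R * weight z (true, y) (inl (i, j))).
    by rewrite pair_bigA; apply: eq_bigr => -[].
  apply: eq_bigr => i _; rewrite big_distrr /= [RHS]big_mkcond /=; apply: eq_bigr => j _.
  by case: ifP => _; rewrite ?mulr0 ?mulr1n // mulrCA.
rewrite sketchE big_sumType /= [X in X + _]big1 ?add0r => [|[i j] _]; last by rewrite mulr0.
rewrite [RHS]big_mkcond /=; apply: eq_bigr => j _.
by case: ifP => _; rewrite ?mulr0.
Qed.

End Sketch.

Lemma big_nat_mul_ord (V : nmodType) n t (G : nat -> V) :
  \sum_(q < n * t) G q = \sum_(e < n) \sum_(l < t) G (e * t + l)%N.
Proof.
rewrite -(big_mkord xpredT G) big_nat_mul big_mkord; apply: eq_bigr => e _.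
by rewrite -{1}[(e * t)%N]add0n big_addn mulSn addnK big_mkord; under eq_bigr => l _ do rewrite addnC.
Qed.

Section Protocol.
Variables (F : finFieldType) (decode : F -> int) (b c C v t m : nat).
Hypotheses (C_gt0 : (0 < C)%N) (t_gt0 : (0 < t)%N).

Local Notation D := ((C + C).-1).
(* The q-th word of the annotation is the (q %% t)-th digit of the coefficient
   of exponent q %/ t %% D of the (q %/ L)-th row polynomial. *)
Local Notation L := (t * D)%N.
Local Notation T := (b * L)%N.

Lemma D_gt0 : (0 < D)%N. Proof. by case: C C_gt0 => // n _; rewrite addnS. Qed.
Lemma L_gt0 : (0 < L)%N. Proof. by rewrite muln_gt0 t_gt0 D_gt0. Qed.

Definition digit (u : word m) : F := (enum_rank u : nat)%:R.

Definition place q : F := #|word m|%:R ^+ (q %% t).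
Definition exponent q : nat := (q %/ t %% D)%N.

(** The part of the coefficient of degree C-1 in row [i] supplied by the first [n] words; at [n]
    equal to the full length it is the claimed entry of the product. *)
Definition rowsum (ds : seq F) n i : F :=
  \sum_(q < n) ds`_q * place q *+ ((q %/ L == i)%N && (exponent q == C.-1)).

Definition fingerprint (z : F * F) (ds : seq F) n : F :=
  \sum_(q < n) ds`_q * place q * z.2 ^+ exponent q * z.1 ^+ (q %/ L).

Definition ann_poly (ds : seq F) i : {poly F} :=
  \sum_(q < T) (ds`_q * place q *: 'X^(exponent q)) *+ (q %/ L == i)%N.

Lemma size_ann_poly ds i : (size (ann_poly ds i) <= D)%N.
Proof.
apply: leq_trans (size_sum _ _ _) _; apply/bigmax_leqP => q _.
case: (_ == _); last by rewrite mulr0n size_poly0.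
by apply: leq_trans (size_scale_leq _ _) _; rewrite size_polyXn ltn_pmod // D_gt0.
Qed.

Lemma coef_ann_poly ds i : (ann_poly ds i)`_C.-1 = rowsum ds T i.
Proof.
rewrite coef_sum; apply: eq_bigr => q _; rewrite coefMn coefZ coefXn eq_sym.
by case: (_ == i); case: (_ == _); rewrite ?mulr1 ?mulr0 ?mul0rn.
Qed.

Lemma fingerprint_ann_poly z ds :
  fingerprint z ds T = \sum_(i < b) z.1 ^+ i * (ann_poly ds i).[z.2].
Proof.
under [RHS]eq_bigr => i _ do rewrite horner_sum big_distrr /=.
rewrite exchange_big /=; apply: eq_bigr => q _.
have qb : (q %/ L < b)%N by rewrite ltn_divLR ?L_gt0.
rewrite (bigD1 (Ordinal qb)) //= big1 => [|i].
  by rewrite eqxx mulr1n addr0 hornerZ hornerXn mulrC.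
by rewrite -val_eqE /= eq_sym => /negPf ->; rewrite mulr0n horner0 mulr0.
Qed.

(** This provides the honest annotation: each coefficient is written as [t] digits, and the sum over
    words is regrouped into blocks of [t], one per coefficient. *)
Lemma ann_poly_surj (U : nat -> {poly F}) :
  (forall x : F, exists g : nat -> word m,
      \sum_(l < t) digit (g l) * #|word m|%:R ^+ l = x) ->
  (forall i, size (U i) <= D)%N ->
  exists2 a : seq (word m), size a = T &
    forall i, (i < b)%N -> ann_poly (map digit a) i = U i.
Proof.
move=> /fin_all_exists[g gE] szU.
exists (mkseq (fun q => g (U (q %/ L)%N)`_(exponent q) (q %% t)%N) T).
  by rewrite size_mkseq.
move=> i ib; apply/polyP => k; case: (leqP D k) => [Dk|kD].
  by rewrite !nth_default // (leq_trans _ Dk) // size_ann_poly.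
have eD : ((i * D + k) %/ D)%N = i by rewrite divnMDl ?D_gt0 // divn_small ?addn0.
have eM : ((i * D + k) %% D)%N = k by rewrite modnMDl modn_small.
have TE : T = (b * D * t)%N by rewrite mulnA mulnAC.
pose h q := digit (g (U (q %/ L)%N)`_(exponent q) (q %% t)%N) * place q *+
              ((q %/ t == i * D + k)%N).
transitivity (\sum_(q < T) h q).
  rewrite coef_sum; apply: eq_bigr => q _.
  rewrite (nth_map (g 0 0%N)) ?size_mkseq // nth_mkseq // coefMn coefZ coefXn /h.
  have -> : (q %/ t == i * D + k)%N = (q %/ L == i)%N && (k == exponent q).
    rewrite /exponent divnMA; apply/eqP/andP => [->|[/eqP <- /eqP ->]].
      by rewrite eD eM !eqxx.
    exact: divn_eq.
  by case: (_ == i); case: (_ == _); rewrite ?mulr1 ?mulr0 ?mul0rn.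
rewrite TE big_nat_mul_ord.
have e_lt : (i * D + k < b * D)%N.
  by apply: (@leq_trans (i.+1 * D)); rewrite ?leq_mul2r ?ib ?orbT // mulSn addnC ltn_add2r.
rewrite (bigD1 (Ordinal e_lt)) //= [X in _ + X]big1 ?addr0 => [|e]; last first.
  rewrite -val_eqE /= => /negPf ne; apply: big1 => l _.
  by rewrite /h divnMDl // (divn_small (ltn_ord l)) addn0 ne.
rewrite -[RHS]gE; apply: eq_bigr => l _; rewrite /h /place /exponent divnMA.
have -> : (((i * D + k) * t + l) %/ t)%N = (i * D + k)%N.
  by rewrite divnMDl // (divn_small (ltn_ord l)) addn0.
by rewrite eqxx mulr1n !modnMDl (modn_small (ltn_ord l)) (modn_small kD) eD.
Qed.

(** The coins, the 2v cells, a word counter, the fingerprint so far and the current row's entry so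
    far. The counter saturates at the length plus one, which marks annotations that are too long. *)
Definition sketch_state : finType :=
  ((F * F) * {ffun bool * 'I_v -> F} * ('I_T.+2 * (F * F)))%type.

Definition sketch_init (z : F * F) : sketch_state := (z, [ffun=> 0], (ord0, (0, 0))).

Definition sketch_item (s : sketch_state) (p : mv_item b c) : sketch_state :=
  let: ((z, M), e) := s in
  ((z, [ffun y => M y + p.2%:~R * weight C z y p.1]), e).

(** An entry is written out at the end of its row, before the test; a final [None] discards
    everything written. *)
Definition sketch_word (s : sketch_state) (u : word m) : sketch_state * seq int :=
  let: ((z, M), (pos, (acc, val))) := s in
  let q := nat_of_ord pos in
  let e := digit u * place q in
  let val' := val + e *+ (exponent q == C.-1) in
  (((z, M), (inord (minn q.+1 T.+1),
     (acc + e * z.2 ^+ exponent q * z.1 ^+ (q %/ L),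
      if (L %| q.+1)%N then 0 else val'))),
   if (L %| q.+1)%N then [:: decode val'] else [::]).

Definition sketch_finish (s : sketch_state) : option (seq int) :=
  let: ((z, M), (pos, (acc, val))) := s in
  if (pos == T :> nat) && (acc == \sum_(y < v) M (true, y) * M (false, y))
  then Some [::] else None.

Lemma foldl_sketch_item z s :
  foldl sketch_item (sketch_init z) s = (z, [ffun y => sketch C s z y], (ord0, (0, 0))).
Proof.
elim/last_ind: s => [|s p IHs].
  by congr (_, _, _); apply/ffunP => y; rewrite !ffunE /sketch big_nil.
rewrite foldl_rcons IHs /=; congr (_, _, _); apply/ffunP => y; rewrite !ffunE.
by rewrite /sketch -cats1 big_cat big_seq1.
Qed.

(** For annotations of wrong length the counter alone decides, whatever the other components
    hold. *)
Lemma fold_pos s a : s.2.1 = ord0 ->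
  (foldl (machine_step sketch_word) (s, [::]) a).1.2.1 = minn (size a) T.+1 :> nat.
Proof.
clear C_gt0 t_gt0 => s0; elim/last_ind: a => [|a u]; first by rewrite /= s0.
rewrite foldl_rcons size_rcons.
case: (foldl _ _ _) => -[[z M] [pos [acc val]]] o /= ->.
by rewrite inordK; lia.
Qed.

Lemma fold_step z M a : (size a <= T)%N ->
  let ds := map digit a in let n := size a in
  foldl (machine_step sketch_word) ((z, M, (ord0, (0, 0))) : sketch_state, [::]) a =
   (((z, M), (inord n, (fingerprint z ds n, rowsum ds n (n %/ L)%N))),
    [seq decode (rowsum ds n i) | i <- iota 0 (n %/ L)%N]).
Proof.
elim/last_ind: a => [_|a u IHa] /=.
  rewrite div0n /= /fingerprint /rowsum !big_ord0; congr ((_, _, (_, _)), _).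
  by apply/val_inj; rewrite /= inordK.
rewrite size_rcons => an; rewrite foldl_rcons IHa 1?ltnW // /machine_step /=.
set n := size a in an *; set ds := map digit a.
have dsn : size ds = n by rewrite size_map.
have inN : (inord n : 'I_T.+2) = n :> nat by rewrite inordK //; lia.
rewrite inN map_rcons -/ds.
have nthS q : (q < n)%N -> (rcons ds (digit u))`_q = ds`_q.
  by move=> qn; rewrite nth_rcons dsn qn.
have nthn : (rcons ds (digit u))`_n = digit u by rewrite nth_rcons dsn ltnn eqxx.
have fpS : fingerprint z (rcons ds (digit u)) n.+1 =
    fingerprint z ds n + digit u * place n * z.2 ^+ exponent n * z.1 ^+ (n %/ L).
  rewrite /fingerprint big_ord_recr /= nthn; congr (_ + _).
  by apply: eq_bigr => q _; rewrite nthS.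
have rsS i : rowsum (rcons ds (digit u)) n.+1 i =
    rowsum ds n i + digit u * place n *+ ((n %/ L == i)%N && (exponent n == C.-1)).
  rewrite /rowsum big_ord_recr /= nthn; congr (_ + _).
  by apply: eq_bigr => q _; rewrite nthS.
have minE : minn n.+1 T.+1 = n.+1 by lia.
rewrite minE fpS.
have rs_old i : (i < n %/ L)%N -> rowsum (rcons ds (digit u)) n.+1 i = rowsum ds n i.
  by move=> iL; rewrite rsS gtn_eqF // mulr0n addr0.
have out_old : [seq decode (rowsum ds n i) | i <- iota 0 (n %/ L)%N] =
    [seq decode (rowsum (rcons ds (digit u)) n.+1 i) | i <- iota 0 (n %/ L)%N].
  by apply/eq_in_map => i; rewrite mem_iota => /andP[_ iL]; rewrite rs_old.
rewrite out_old divnS ?L_gt0 //; case: ifP => [Ln|nLn] /=; last first.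
  by rewrite add0n cats0 rsS eqxx.
(* At the end of a row the accumulator restarts at 0, since no word read so far belongs to the next
   row. *)
congr ((_, (_, (_, _))), _).
  rewrite /rowsum big1 // => q _; rewrite ltn_eqF ?mulr0n //.
  by rewrite ltnS leq_div2r // -ltnS.
rewrite -[RHS]/([seq decode (rowsum (rcons ds (digit u)) n.+1 i) | i <- iota 0 (1 + n %/ L)%N]).
by rewrite addnC iotaD map_cat /= add0n rsS eqxx.
Qed.

End Protocol.

(** * Completeness and soundness of the protocol *)

Lemma Pr_allT (I : Type) (O : eqType) (m w : nat) (V : verifier I O m w) (P : pred (coins V)) :
  (0 < #|{: coins V}|)%N -> (forall r, P r) -> Pr P = 1.
Proof.
move=> c_gt0 allP; rewrite /Pr (eq_card (B := coins V)) => [|r].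
  by rewrite divff // pnatr_eq0 -lt0n.
by rewrite !inE; apply: allP.
Qed.

Section Validity.
Variables (F : finFieldType) (decode : F -> int) (b c C v t m w : nat).
Hypotheses (C_gt0 : (0 < C)%N) (t_gt0 : (0 < t)%N) (c_ub : (c <= C * v)%N).

Local Notation D := ((C + C).-1).
Local Notation T := (b * (t * D))%N.
Local Notation St := (sketch_state F b C v t).

Hypothesis F_large : (3 * (D + b) <= #|F|)%N.
Hypothesis digits : forall x : F, exists g : nat -> word m,
  \sum_(l < t) digit F (g l) * #|word m|%:R ^+ l = x.

Variables (enc : St -> w.-tuple (word m)) (dec : w.-tuple (word m) -> St).
Hypothesis encK : cancel enc dec.

Variable S : seq (mv_item b c) -> Prop.
Hypothesis decodeK : forall s, S s -> forall i,
  decode (((stream_matrix s *m stream_vector s) i 0)%:~R) =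
  (stream_matrix s *m stream_vector s) i 0.

Definition mv_verifier : verifier (mv_item b c) int m w :=
  machine_verifier enc dec (@sketch_init F b C v t) (@sketch_item F b c C v t)
    (@sketch_word F decode b C v t m) (@sketch_finish F b C v t).

(** Extended by 0 beyond the last row, to match [ann_poly], whose rows are indexed by naturals. *)
Definition target (s : seq (mv_item b c)) (i : nat) : {poly F} :=
  if insub i is Some i' then
    row_poly C v (fun j => (entry s (inl (i' : 'I_b, j)))%:~R)
                 (fun j => (entry s (inr j))%:~R)
  else 0.

Lemma targetE s (i : 'I_b) : target s i =
  row_poly C v (fun j => (entry s (inl (i, j)))%:~R) (fun j => (entry s (inr j))%:~R).
Proof. by rewrite /target valK. Qed.

Lemma size_target s i : (size (target s i) <= D)%N.
Proof. by rewrite /target; case: insub => [i'|]; rewrite ?size_row_poly // size_poly0. Qed.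

Lemma coef_target s (i : 'I_b) :
  (target s i)`_C.-1 = ((stream_matrix s *m stream_vector s) i 0)%:~R.
Proof.
rewrite targetE coef_row_poly // mxE rmorph_sum; apply: eq_bigr => j _.
by rewrite !mxE rmorphM.
Qed.

(** This reduces a run to one polynomial identity test at a random point: the fingerprint minus the
    dot product of the sketches combines the differences between claimed and true row
    polynomials. *)
Lemma mv_output (z : F * F) s a :
  output (V := mv_verifier) z s a =
  if (size a == T) && (\sum_(i < b) z.1 ^+ i *
       (ann_poly b C t m (map (@digit F m) a) i - target s i).[z.2] == 0)
  then Some [seq decode (ann_poly b C t m (map (@digit F m) a) i)`_C.-1 | i <- iota 0 b]
  else None.
Proof.
rewrite machine_output // foldl_sketch_item; set st0 := (z, _, _).
case: (eqVneq (size a) T) => [szT|szT]; last first.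
  have := @fold_pos F decode b C v t m st0 a erefl.
  case: (foldl _ _ _) => -[[z' M] [pos [acc val]]] o /= ->.
  rewrite (_ : (minn (size a) T.+1 == T)%N = false) //.
  case: (leqP (size a) T) => [le_aT|lt_Ta]; first by rewrite (minn_idPl (leqW le_aT)) (negPf szT).
  by rewrite (minn_idPr lt_Ta) gtn_eqF.
rewrite fold_step ?szT //= inordK ?ltnS ?leqnSn // eqxx /=.
rewrite fingerprint_ann_poly // mulnK ?(L_gt0 C_gt0 t_gt0) //.
have -> : \sum_(y < v) [ffun y => sketch C s z y] (true, y) *
            [ffun y => sketch C s z y] (false, y) =
          \sum_(i < b) z.1 ^+ i * (target s i).[z.2].
  under eq_bigr => y _ do rewrite !ffunE.
  by rewrite sketch_dot; apply: eq_bigr => i _; rewrite targetE.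
under [in RHS]eq_bigr => i _ do rewrite hornerD hornerN mulrBr.
rewrite sumrB subr_eq0.
case: ifP => _ //=; congr Some; rewrite cats0.
by apply/eq_map => i; rewrite coef_ann_poly.
Qed.

Lemma mv_product_iota (s : seq (mv_item b c)) : mv_product s =
  [seq (if insub i is Some i' then (stream_matrix s *m stream_vector s) (i' : 'I_b) 0 else 0)
     | i <- iota 0 b].
Proof.
rewrite /mv_product -val_enum_ord -map_comp; apply: eq_map => i /=.
by rewrite valK.
Qed.

Lemma coins_mv_verifier_gt0 : (0 < #|{: coins mv_verifier}|)%N.
Proof. by apply/card_gt0P; exists (0, 0). Qed.

Lemma good_annotation (H : helper (mv_item b c) m) s : S s -> size (H s) = T ->
  (forall i : 'I_b, ann_poly b C t m (map (@digit F m) (H s)) i = target s i) ->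
  valid_helper mv_verifier (@mv_product b c) H s.
Proof.
move=> Ss szH annE; apply: Pr_allT coins_mv_verifier_gt0 _ => z.
rewrite /= mv_output szH eqxx big1 => [|i _].
  rewrite eqxx mv_product_iota /=; apply/eqP; congr Some; apply/eq_in_map => i.
  rewrite mem_iota /= add0n => ib; rewrite (annE (Ordinal ib)) coef_target decodeK //.
  by rewrite insubT.
by rewrite annE subrr horner0 mulr0.
Qed.

Lemma mv_help_cost_le : help_cost_le mv_verifier (@mv_product b c) S T.
Proof.
have honest s : {a : seq (word m) | size a = T &
    forall i, (i < b)%N -> ann_poly b C t m (map (@digit F m) a) i = target s i}.
  by apply: cid2; apply: ann_poly_surj => // i; exact: size_target.
exists (fun s => s2val (honest s)) => s Ss; have := s2valP (honest s); have := s2valP' (honest s).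
move=> annE sza; split; last by rewrite sza.
by apply: good_annotation => // i; exact: annE.
Qed.

(** An annotation of wrong length is never accepted, and one with all row polynomials correct is
    valid. If some row differs, at most |F| (D + b) of the |F|^2 coins accept, which is at most a
    third by [F_large]. *)
Lemma mv_valid_protocol : valid_protocol mv_verifier (@mv_product b c) S.
Proof.
split=> [|H s Ss].
  by have [H goodH] := mv_help_cost_le; exists H => s /goodH[].
case: (eqVneq (size (H s)) T) => szH; last first.
  right; rewrite /third_invalid_helper /Pr (eq_card0 (A := [pred _ | _])).
    by rewrite mul0r divr_ge0.
  by move=> z; rewrite !inE mv_output (negPf szH).
case: (boolP [forall i : 'I_b, ann_poly b C t m (map (@digit F m) (H s)) i == target s i]).
  by move/forallP=> annE; left; apply: good_annotation => // i; apply/eqP.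
rewrite negb_forall => /existsP[i0]; rewrite -subr_eq0 => ne0; right.
rewrite /third_invalid_helper /Pr ler_pdivrMr; last by rewrite ltr0n coins_mv_verifier_gt0.
rewrite mulrAC ler_pdivlMr ?ltr0n // mul1r -natrM ler_nat mulnC.
pose U i := ann_poly b C t m (map (@digit F m) (H s)) i - target s i.
have szU : (size (U i0) <= D)%N.
  apply: leq_trans (size_polyD _ _) _.
  by rewrite geq_max size_ann_poly // size_polyN size_target.
have := card_common_roots_leq ne0 szU.
rewrite (eq_card (B := [pred z | output (V := mv_verifier) z s (H s) != None])) => [ub|z].
  apply: leq_trans (leq_mul (leqnn 3) ub) _.
  by rewrite mulnCA card_prod leq_mul2l F_large orbT.
by rewrite !inE mv_output szH eqxx /=; case: ifP.
Qed.

Lemma mv_help_cost : exists2 n, help_cost mv_verifier (@mv_product b c) S n & (n <= T)%N.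
Proof.
pose P n := `[< help_cost_le mv_verifier (@mv_product b c) S n >].
have exP : exists n, P n by exists T; apply/asboolP; exact: mv_help_cost_le.
case: (ex_minnP exP) => n /asboolP Pn n_min; exists n.
  by split=> // n' /asboolP; exact: n_min.
by apply: n_min; apply/asboolP; exact: mv_help_cost_le.
Qed.

End Validity.

(** * Choice of the prime and of the block sizes *)

Lemma entry_bound b c B (s : seq (mv_item b c)) k : uniq [seq p.1 | p <- s] ->
  (forall p, p \in s -> `|p.2| <= B)%N -> (`|entry s k| <= B)%N.
Proof.
rewrite /entry; elim: s => [|p s IHs] /=; first by rewrite big_nil.
move=> /andP[p_s uniq_s] leB; rewrite big_cons.
have leB' q : q \in s -> (`|q.2| <= B)%N by move=> qs; rewrite leB // in_cons qs orbT.
case: eqP => [pk|_]; last exact: IHs.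
rewrite big1_seq ?addr0 ?leB ?mem_head // => q /andP[/eqP qk qs].
by case/negP: p_s; rewrite pk -qk map_f.
Qed.

Lemma mv_product_bound b c m kappa (s : seq (mv_item b c)) i : mv_stream m kappa s ->
  (`|(stream_matrix s *m stream_vector s : 'cV_b) i 0%R| <= c * (m ^ kappa * m ^ kappa))%N.
Proof.
case=> _ uniq_s le_s; rewrite mxE -lez_nat abszE.
apply: le_trans (ler_norm_sum _ _ _) _.
have -> : (c * (m ^ kappa * m ^ kappa))%N%:Z =
    \sum_(j < c) (m ^ kappa * m ^ kappa)%N%:Z.
  by rewrite sumr_const card_ord -mulr_natl natz -PoszM.
apply: ler_sum => j _; rewrite !mxE normrM -!abszE -PoszM lez_nat.
by rewrite leq_mul // entry_bound.
Qed.

Lemma leq_word_range m : (m <= 2 ^ word_bits m)%N.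
Proof. by rewrite ltnW // trunc_log_ltn. Qed.

Lemma Fp_digits p m t : prime p -> (p <= #|word m| ^ t)%N ->
  forall x : 'F_p, exists g : nat -> word m,
    \sum_(l < t) digit 'F_p (g l) * #|word m|%:R ^+ l = x.
Proof.
move=> p_pr p_ub x.
have N_gt0 : (0 < #|word m|)%N by rewrite card_word expn_gt0.
exists (fun l => enum_val (Ordinal (ltn_pmod (x %/ #|word m| ^ l) N_gt0))).
transitivity ((x : nat)%:R : 'F_p); last exact: natr_Zp.
have x_lt : (x < #|word m| ^ t)%N.
  by apply: leq_trans p_ub; rewrite -[leqRHS](card_Fp p_pr) card_ord.
rewrite -[in RHS](sum_digits N_gt0 x_lt) natr_sum; apply: eq_bigr => l _.
by rewrite /digit enum_valK /= natrM natrX.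
Qed.

(** A field element takes [t] words. The state takes 2v cells and six more such slots: two for the
    coins, two for the fingerprint and the row entry, two for the counter. *)
Lemma mv_upper_bound_nat kappa b c C v m : (0 < b)%N -> (0 < c)%N ->
  (b * c <= m ^ kappa)%N -> (0 < v)%N -> (0 < C <= c)%N -> (c <= C * v)%N ->
  let t := (6 * kappa + 12)%N in
  exists V : verifier (mv_item b c) int m (t * (2 * v + 6)),
    [/\ coins_in_memory V,
        valid_protocol V (@mv_product b c) (@mv_stream b c m kappa) &
        exists2 n, help_cost V (@mv_product b c) (@mv_stream b c m kappa) n
                 & (n <= b * (t * (C + C).-1))%N].
Proof.
move=> b_gt0 c_gt0 Q_lb v_gt0 /andP[C_gt0 C_le] c_ub t.
set Q := (m ^ kappa)%N in Q_lb; set wb := word_bits m.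
(* The exponent makes p exceed 16 Q^3, enough for recovering entries of absolute value at most c Q^2
   and for soundness. The upper bound is then 2^(6 kappa wb + 12), which is where [t] comes from. *)
have [p p_pr /andP[p_lb p_ub]] := prime_between_pow2 (3 * kappa * wb + 4).
have Q3 : (16 * (Q * Q * Q) < p)%N.
  apply: leq_ltn_trans p_lb; rewrite expnD mulnC leq_mul2r /=.
  have -> : (Q * Q * Q = m ^ (3 * kappa))%N by rewrite -!expnD; congr (_ ^ _)%N; lia.
  rewrite (mulnC (3 * kappa)%N) [leqRHS]expnM; case: (3 * kappa)%N => // k; rewrite leq_exp2r //.
  exact: leq_word_range.
have p_ub' : (p <= #|word m| ^ t)%N.
  apply: leq_trans p_ub _; rewrite card_word -expnM leq_exp2l //.
  by have : (0 < wb)%N by []; rewrite /t -/wb; nia.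
have cQ : (c <= Q)%N by apply: leq_trans Q_lb; rewrite leq_pmull.
have F_large : (3 * ((C + C).-1 + b) <= #|'F_p|)%N.
  rewrite card_Fp //; nia.
have decodeK (s : seq (mv_item b c)) : mv_stream m kappa s -> forall i : 'I_b,
    int_of_Fp (((stream_matrix s *m stream_vector s) i 0)%:~R : 'F_p) =
    (stream_matrix s *m stream_vector s : 'M_(b, 1)) i 0.
  move=> Ss i; apply: int_of_FpK => //.
  have := mv_product_bound i Ss; rewrite -/Q.
  have cQ3 : (c * (Q * Q) <= Q * (Q * Q))%N by rewrite leq_mul2r cQ orbT.
  move: (absz _) => z; lia.
have t_gt0 : (0 < t)%N by rewrite /t; lia.
have card_St : (#|sketch_state 'F_p b C v t| <= #|{: (t * (2 * v + 6)).-tuple (word m)}|)%N.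
  rewrite !card_prod card_ffun !card_prod !card_ord card_bool card_tuple [leqRHS]expnM.
  have pE : (Zp_trunc (pdiv p)).+2 = p by have := card_Fp p_pr; rewrite card_ord.
  set X := (#|word m| ^ t)%N in p_ub' *.
  have tX : (t < X)%N.
    apply: leq_trans (ltn_expl t (ltnSn 1)) _.
    by rewrite leq_exp2r // card_word -{1}(expn1 2) leq_exp2l.
  have T_ub : ((b * (t * (C + C).-1)).+2 <= X * X)%N.
    have bC : (b * (C + C).-1 <= 2 * Q)%N.
      apply: (@leq_trans (b * (2 * c))); first by rewrite leq_mul2l; lia.
      by rewrite mulnCA leq_mul2l Q_lb orbT.
    have : (t * (b * (C + C).-1) <= t * (2 * Q))%N by rewrite leq_mul2l bC orbT.
    have : (t * X <= X * X)%N by rewrite leq_mul2r (ltnW tX) orbT.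
    have : (t * (4 * Q) <= t * X)%N.
      by rewrite leq_mul2l (leq_trans _ p_ub') ?orbT //; nia.
    nia.
  rewrite pE; apply: (@leq_trans (X * X * X ^ (2 * v) * (X * X * (X * X)))).
    have pp := leq_mul p_ub' p_ub'.
    apply: leq_mul (leq_mul pp _) (leq_mul T_ub pp).
    by rewrite leq_exp2r // muln_gt0.
  by rewrite expnD !expnS; lia.
have [enc [dec encK]] := card_leq_cancel (sketch_init b C v t ((0, 0) : 'F_p * 'F_p)) card_St.
exists (@mv_verifier 'F_p (@int_of_Fp p) b c C v t m _ enc dec); split.
- exact: machine_coins_in_memory.
- by apply: mv_valid_protocol => //; exact: Fp_digits.
- by apply: mv_help_cost => //; exact: Fp_digits.
Qed.

Lemma mv_upper_bound (R : realType) (alpha : R) (kappa : nat) : 0 <= alpha <= 1 ->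
  exists K : R, forall b c m : nat,
     (0 < b)%N -> (0 < c)%N -> (b * c <= m ^ kappa)%N ->
     exists (w : nat) (V : verifier (mv_item b c) int m w),
       coins_in_memory V /\
       hv_protocol V (@mv_product b c) (@mv_stream b c m kappa)
         K (b%:R * c%:R `^ alpha) (c%:R `^ (1 - alpha)).
Proof.
move=> /andP[alpha_ge0 alpha_le1]; set t := (6 * kappa + 12)%N.
(* The 8 comes from the memory: 2v + 6 <= 2y + 8 <= 8 (y + 1), with y = c^(1-alpha). *)
exists (8 * t%:R) => b c m b_gt0 c_gt0 bc_le.
have c1 : 1 <= c%:R :> R by rewrite ler1n.
set x := c%:R `^ alpha; set y := c%:R `^ (1 - alpha).
have x1 : 1 <= x by rewrite -(powRr0 c%:R) ler_powR.
have y1 : 1 <= y by rewrite -(powRr0 c%:R) ler_powR // subr_ge0.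
have xy : x * y = c%:R.
  rewrite /x /y -powRD; last by rewrite pnatr_eq0 -lt0n c_gt0 implybT.
  by rewrite addrCA subrr addr0 powRr1.
(* [v] exceeds c^(1-alpha) by at most 1 and [C] is c / v rounded up; hence C - 1 <= c / v <=
   c^alpha. *)
pose v := (Num.truncn y).+1; pose C := (c.-1 %/ v).+1.
have y_lt : y < v%:R := truncnS_gt y.
have v_le : v%:R <= y + 1.
  by rewrite /v -natr1 lerD2r truncn_le // (le_trans ler01).
have C_le : C.-1%:R <= x.
  have : (C.-1 * v <= c)%N by rewrite (leq_trans (leq_trunc_div _ _)) ?leq_pred.
  rewrite -(ler_nat R) natrM -xy => le_xy.
  rewrite -(ler_pM2r (lt_le_trans ltr01 y1)); apply: le_trans le_xy.
  by rewrite ler_wpM2l // ltW.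
have c_ub : (c <= C * v)%N by rewrite -[c in leqLHS]prednK // ltn_ceil.
have C_c : (0 < C <= c)%N.
  by rewrite /= -[leqRHS](prednK c_gt0) ltnS leq_div.
have [V [memV validV [n costV n_le]]] := mv_upper_bound_nat b_gt0 c_gt0 bc_le (ltn0Sn _ : (0 < v)%N) C_c c_ub.
exists (t * (2 * v + 6))%N, V; split=> //; split=> //.
  exists n => //; apply: (@le_trans _ _ (b * (t * (C + C).-1))%:R); first by rewrite ler_nat.
  have -> : (C + C).-1 = (2 * C.-1 + 1)%N by rewrite /C addnS /= addn1 mul2n -addnn.
  rewrite !natrM natrD natrM.
  have bt_ge0 : 0 <= b%:R * t%:R :> R by rewrite mulr_ge0.
  have D_le : 2 * C.-1%:R + 1 <= 8 * x by lra.
  apply: (@le_trans _ _ (8 * t%:R * (b%:R * x))); last first.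
    by rewrite ler_wpM2l ?mulr_ge0 // lerDl.
  rewrite mulrA (_ : 8 * t%:R * (b%:R * x) = b%:R * t%:R * (8 * x)) ?ler_wpM2l //.
  by ring.
rewrite natrM natrD natrM -mulrA mulrCA ler_wpM2l //.
by move: (v%:R : R) v_le => V_ V_le; lra.
Qed.

Theorem theorem4 (R : realType) (alpha : R) (kappa : nat) :
  0 <= alpha <= 1 ->
  (exists K : R, forall b c m : nat,
     (0 < b)%N -> (0 < c)%N -> (b * c <= m ^ kappa)%N ->
     exists (w : nat) (V : verifier (mv_item b c) int m w),
       coins_in_memory V /\
       hv_protocol V (@mv_product b c) (@mv_stream b c m kappa)
         K (b%:R * c%:R `^ alpha) (c%:R `^ (1 - alpha)))
  /\
  (forall delta : R, 0 < delta <= 1 ->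
   exists2 K : R, 0 < K & forall b c m : nat,
     (0 < b)%N -> (0 < c)%N ->
     delta * b%:R * c%:R + c%:R <= m%:R -> (m <= b * c + c)%N ->
     forall (w : nat) (V : verifier (mv_item b c) int m w) (h : nat),
       valid_protocol V (@mv_product b c)
         (@dense_mv_stream b c R delta m kappa) ->
       help_cost V (@mv_product b c)
         (@dense_mv_stream b c R delta m kappa) h ->
       K * (minn c b ^ 2)%:R <=
         (maxn (h * word_bits m) 1)%:R * (w * word_bits m)%:R).
Proof.
move=> alpha01; split; first exact: mv_upper_bound.
by move=> delta; exact: mv_lower_bound.
Qed.
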